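(* Let $\{a_n\}_{n\ge1}$ and $\{c_n\}_{n\ge1}$ be sequences of positive real numbers. The series $\sum c_n a_n$ converges if and only if there exist a sequence $\{q_n\}_{n\ge 1}$ of positive real numbers and a positive integer $N\geq 1$ for which $$q_n\frac{a_n}{a_{n+1}}-q_{n+1}\geq c_{n+1}, \qquad n\geq N.$$ *)

(* Defs.v *)
From Stdlib Require Export Reals.
From Coquelicot Require Export Coquelicot.

(* Main.v *)
Require Import Defs.
From Stdlib Require Import Reals Lra Lia.
From Coquelicot Require Import Coquelicot.
Open Scope R_scope.

(** Multiplying the inequality by [a (S n)] turns it, with [u n = q n * a n],
    into [c (S n) * a (S n) <= u n - u (S n)].  So the theorem says that a
    series of positive terms converges exactly when its terms are eventually
    dominated by the decrements of a positive sequence [u].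

    If such a [u] exists, the partial sums telescope and stay below the first
    value of [u], so they converge ([ex_series_le_decrements]).  Conversely, the
    remainders of a convergent positive series form such a [u], with equality
    in the inequality: removing the first term of a remainder leaves the next
    one ([Series_tail_step], [Series_tail_pos]).  Dividing by [a n] recovers
    [q n]. *)

(** The partial sums increase, and by telescoping
    [sum_n b n <= u 0 - u (S n) <= u 0]. *)
Lemma ex_series_le_decrements (b u : nat -> R) :
  (forall n, 0 <= b n) -> (forall n, 0 <= u n) ->
  (forall n, b n <= u n - u (S n)) -> ex_series b.
Proof.
  intros hb hu hbu.
  assert (hsum : forall n, sum_n b n <= u 0%nat - u (S n)).
  { induction n as [|n IH].
    - rewrite sum_O. apply hbu.
    - rewrite sum_Sn. unfold plus; simpl. specialize (hbu (S n)). lra. }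
  destruct (ex_finite_lim_seq_incr (sum_n b) (u 0%nat)) as [l hl].
  - intro n. rewrite sum_Sn. unfold plus; simpl. specialize (hb (S n)). lra.
  - intro n. specialize (hsum n). specialize (hu (S n)). lra.
  - exists l. exact hl.
Qed.

Lemma Series_tail_step (b : nat -> R) (n : nat) :
  ex_series b ->
  Series (fun k => b (n + k)%nat) = b n + Series (fun k => b (S n + k)%nat).
Proof.
  intro hb.
  rewrite Series_incr_1 by now apply (ex_series_incr_n b).
  rewrite Nat.add_0_r. f_equal.
  apply Series_ext. intro k. f_equal. lia.
Qed.

Lemma Series_tail_pos (b : nat -> R) (n : nat) :
  (forall k, 0 < b k) -> ex_series b -> 0 < Series (fun k => b (n + k)%nat).
Proof.
  intros hpos hb.
  rewrite Series_tail_step by exact hb.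
  assert (hrest : Series (fun _ => 0) <= Series (fun k => b (S n + k)%nat)).
  { apply Series_le.
    - intro k. specialize (hpos (S n + k)%nat). lra.
    - now apply (ex_series_incr_n b). }
  assert (hzero : Series (fun _ => 0) = 0).
  { rewrite (Series_ext _ (fun k => 0 * b k)) by (intro; ring).
    rewrite Series_scal_l. ring. }
  specialize (hpos n). lra.
Qed.

(* Stdlib reals with Coquelicot.  Sequences are functions on nat whose
   value at 0 is never used; the series is the sum over n >= 1. *)
Theorem theorem3p1 :
  forall (a c : nat -> R)
    (ha : forall n : nat, (1 <= n)%nat -> 0 < a n)
    (hc : forall n : nat, (1 <= n)%nat -> 0 < c n),
  ex_series (fun n : nat => c (S n) * a (S n)) <->
  exists (q : nat -> R) (N : nat),
    (forall n : nat, (1 <= n)%nat -> 0 < q n) /\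
    (1 <= N)%nat /\
    (forall n : nat, (N <= n)%nat ->
       q n * (a n / a (S n)) - q (S n) >= c (S n)).
Proof.
  intros a c ha hc.
  set (b := fun n : nat => c (S n) * a (S n)).
  assert (hb : forall n, 0 < b n).
  { intro n. apply Rmult_lt_0_compat; [apply hc | apply ha]; lia. }
  split.
  - intro hconv.
    (* [b] is shifted by one, so its tail from [n] is the sum of
       [c k * a k] over [k > n]. *)
    exists (fun n => Series (fun k => b (n + k)%nat) / a n), 1%nat.
    split; [|split].
    + intros n hn. apply Rdiv_lt_0_compat; [|now apply ha].
      now apply Series_tail_pos.
    + lia.
    + intros n hn. right.
      rewrite (Series_tail_step b n hconv).
      assert (han := ha n hn).
      assert (haSn : 0 < a (S n)) by (apply ha; lia).
      unfold b at 1. field. lra.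
  - intros (q & N & hq & hN & hineq).
    apply (ex_series_incr_n b N).
    apply (ex_series_le_decrements _ (fun k => q (N + k)%nat * a (N + k)%nat)).
    + intro k. apply Rlt_le, hb.
    + intro k. apply Rlt_le, Rmult_lt_0_compat; [apply hq | apply ha]; lia.
    + intro k. rewrite Nat.add_succ_r.
      specialize (hineq (N + k)%nat ltac:(lia)).
      assert (haS : 0 < a (S (N + k))) by (apply ha; lia).
      apply Rge_le, (Rmult_le_compat_r (a (S (N + k)))) in hineq; [|lra].
      unfold b.
      replace (q (N + k)%nat * a (N + k)%nat)
        with (q (N + k)%nat * (a (N + k)%nat / a (S (N + k))) * a (S (N + k)))
        by (field; lra).
      lra.
Qed.
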